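(* Let $(\mathcal X,d_{\mathcal X})$ and $(\mathcal U,d_{\mathcal U})$ be metric spaces, let $p\ge1$ and $P,Q\in\mathcal P_p(\mathcal X)$. Let $\mathcal S\colon\mathcal X\to\mathcal U$ be Hölder continuous with exponent $\beta\in(0,1]$ and constant $C_{\mathcal S}<\infty$, i.e. $$d_{\mathcal U}(\mathcal S(x_1),\mathcal S(x_2))\le C_{\mathcal S}\,d_{\mathcal X}(x_1,x_2)^\beta\qquad\text{for all }x_1,x_2\in\mathcal X.$$ Then the pushforward measures $\mathcal S_*P,\mathcal S_*Q$ on $\mathcal U$ satisfy $$d_p(\mathcal S_*P,\mathcal S_*Q)\le C_{\mathcal S}\,d_{\beta p}(P,Q)^\beta\le C_{\mathcal S}\,d_p(P,Q)^\beta.$$ In particular, $\mathcal S_*P,\mathcal S_*Q\in\mathcal P_p(\mathcal U)$.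
   Context: Metric spaces carry their Borel $\sigma$-algebras; $\mathcal P(\mathcal X)$ is the set of Borel probability measures on $\mathcal X$. For $q>0$, $\mathcal P_q(\mathcal X)=\{P\in\mathcal P(\mathcal X)\colon \int d_{\mathcal X}(x,x_0)^q\,P(dx)<\infty\text{ for some }x_0\in\mathcal X\}$ and $$d_q(P,Q)=\inf_{\pi\in\Pi(P,Q)}\Big(\iint_{\mathcal X\times\mathcal X}d_{\mathcal X}(x,y)^q\,\pi(dx,dy)\Big)^{1/q},$$ where $\Pi(P,Q)$ is the set of all $\pi\in\mathcal P(\mathcal X\times\mathcal X)$ with first marginal $P$ and second marginal $Q$. The same notation is used on $\mathcal U$ with $d_{\mathcal U}$. $\mathcal S_*P=P\circ\mathcal S^{-1}$. *)

(* Defs.v *)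
From HB Require Import structures.
From mathcomp Require Import all_boot all_order all_algebra.
From mathcomp Require Import all_classical all_reals all_analysis.

Set Implicit Arguments.
Unset Strict Implicit.
Unset Printing Implicit Defensive.

Import Order.TTheory GRing.Theory Num.Theory.
Import numFieldNormedType.Exports.

Local Open Scope classical_set_scope.
Local Open Scope ring_scope.

(* Measurable types are pointed in the library. Asking metric spaces to be
   nonempty excludes nothing here: an empty space carries no probability
   measure, and the codomain of a map defined on a nonempty space is
   nonempty. *)
#[short(type="pmetricType")]
HB.structure Definition PointedMetric (K : numDomainType) :=
  { M of Metric K M & isPointed M }.

Notation borelType X := (g_sigma_algebraType (@open X)).

Section wasserstein.
Context {R : realType} {X : pmetricType R}.
Implicit Types (q : R) (P Q : probability (borelType X) R).
Local Open Scope ereal_scope.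

Definition finite_moment q : set (probability (borelType X) R) :=
  [set P : probability (borelType X) R |
    exists x0 : X, \int[P]_x (@mdist R X x x0 `^ q)%:E < +oo].

(* Couplings live on the Borel sigma-algebra of X * X, which may be strictly
   larger than the product of the Borel sigma-algebras if X is not
   separable. *)
Definition couplings P Q : set (probability (borelType (X * X)%type) R) :=
  [set pi | (forall A : set (borelType X), measurable A ->
               pushforward pi (fst : borelType (X * X)%type -> borelType X) A
               = P A)
         /\ (forall A : set (borelType X), measurable A ->
               pushforward pi (snd : borelType (X * X)%type -> borelType X) A
               = Q A)].

(* Extended-real valued: +oo if no coupling has finite cost. *)
Definition wasserstein q P Q : \bar R :=
  ereal_inf [set (\int[pi]_z (@mdist R X z.1 z.2 `^ q)%:E) `^ q^-1
            | pi in couplings P Q].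

End wasserstein.

Section holder.
Context {R : realType} {X U : pmetricType R}.

Definition holder_continuous (C b : R) (S : X -> U) : Prop :=
  forall x1 x2 : X, mdist (S x1) (S x2) <= C * mdist x1 x2 `^ b.

Variables (C b : R) (S : X -> U).
Hypotheses (b_gt0 : 0 < b) (hS : holder_continuous C b S).

Lemma holder_continuous_continuous : continuous S.
Proof.
move=> x; apply/cvg_ballP => e e0.
have C0 : 0 < `|C| + 1 by rewrite ltr_wpDl.
have r0 : 0 < (e / (`|C| + 1)) `^ b^-1 by rewrite powR_gt0// divr_gt0.
apply/nbhs_ballP; exists ((e / (`|C| + 1)) `^ b^-1) => //= y.
rewrite !ballEmdist/= => xy; apply: le_lt_trans (hS x y) _.
have : mdist x y `^ b < e / (`|C| + 1).
  rewrite (_ : e / _ = ((e / (`|C| + 1)) `^ b^-1) `^ b); last first.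
    by rewrite -powRrM mulVf ?gt_eqF// powRr1// ltW// divr_gt0.
  by rewrite gt0_ltr_powR// nnegrE ?mdist_ge0// ltW.
rewrite ltr_pdivlMr// mulrC => /(le_lt_trans _); apply.
rewrite ler_wpM2r// ?powR_ge0//.
by rewrite (le_trans (ler_norm _))// lerDl.
Qed.

Lemma holder_continuous_measurable :
  measurable_fun setT (S : borelType X -> borelType U).
Proof.
apply: (@measurability _ _ (borelType X) (borelType U) setT S (@open U)) => //.
move=> _ [B oB <-]; rewrite setTI; apply: sub_sigma_algebra.
by move/continuousP : holder_continuous_continuous => /(_ _ oB).
Qed.

Definition holder_mfun : {mfun borelType X >-> borelType U} :=
  @mfun_Sub _ _ (borelType X) (borelType U) S
    (mem_set holder_continuous_measurable).

End holder.

(* Main.v *)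
From HB Require Import structures.
Require Import Defs.
From mathcomp Require Import all_boot all_order all_algebra.
From mathcomp Require Import all_classical all_reals all_analysis.
From mathcomp Require Import measurable_realfun lra ring.
Import Order.TTheory GRing.Theory Num.Theory.
Import numFieldNormedType.Exports.
Local Open Scope classical_set_scope.
Local Open Scope ring_scope.

(** Let pi be any coupling of P and Q. Its image under S x S is a coupling of
    the pushforwards, and raising the Hoelder condition to the power p bounds
    the cost of that image by C^p times the integral of d^(b p) against pi
    ([wasserstein_holder]). Since 1/p = b / (b p), taking the p-th root and the
    infimum over pi gives the first inequality. The second one is the
    monotonicity of the distance in its exponent
    ([wasserstein_le_exponent]): on a probability space the L^q norms increase
    with q, which is Jensen's inequality for the concave map t |-> t^b
    ([jensen_powR]). The same inequality bounds the moment of order b p of P by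
    its moment of order p, and this bounds the moment of order p of the
    pushforward around the image of the base point ([finite_moment_holder]).

    Infima over possibly empty sets of couplings are compared directly in the
    extended reals. Couplings live on the Borel sigma-algebra of the product
    topology, so the measurability of S x S and of the cost come from their
    continuity.

    The scaling argument divides by C, hence covers C > 0. If C <= 0, then S is
    constant and the two pushforwards coincide, so their distance is 0; if
    moreover C < 0, then X is a single point, P and Q coincide, and both upper
    bounds are 0. *)

(** * Jensen's inequality for powers *)

(** Hoelder's inequality for f^b and the constant 1, with the conjugate
    exponents 1/b and 1/(1-b), which degenerate at b = 1. *)
Lemma jensen_powR {d} {T : measurableType d} {R : realType}
    (mu : probability T R) (f : T -> R) (b : R) :
  measurable_fun setT f -> (forall x, 0 <= f x) -> 0 < b -> b <= 1 ->
  (\int[mu]_x (f x `^ b)%:E <= (\int[mu]_x (f x)%:E) `^ b)%E.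
Proof.
move=> mf f0 b0; rewrite le_eqVlt => /predU1P[->|b1].
  under eq_integral do rewrite powRr1//.
  by rewrite poweRe1//; apply: integral_ge0 => x _; rewrite lee_fin.
have mfb : measurable_fun setT (fun x => f x `^ b).
  exact: (measurableT_comp (measurable_powR b)).
have p0 : 0 < b^-1 by rewrite invr_gt0.
have q0 : 0 < (1 - b)^-1 by rewrite invr_gt0 subr_gt0.
have pq : b^-1^-1 + (1 - b)^-1^-1 = 1 by rewrite !invrK subrKC.
have := hoelder mu mfb (@measurable_cst _ _ _ _ setT (1 : R)) p0 q0 pq.
rewrite Lnorm_cst1 [X in (_ * X)%E](_ : _ = 1%E); last first.
  by rewrite [X in (X `^ _)%E]probability_setT poweR1r.
rewrite mule1 Lnorm1.
under eq_integral do rewrite /= mulr1 ger0_norm ?powR_ge0//.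
rewrite unlock /= invrK.
under [in leRHS]eq_integral do
  rewrite /= ger0_norm ?powR_ge0// -powRrM mulfV ?gt_eqF// powRr1//.
by [].
Qed.

(** * Continuous maps are Borel *)

(** This join makes the Borel sigma-algebra of a product topology available to
    the lemmas below, which ask for a single pointed topological type. *)
HB.instance Definition _ (T T' : ptopologicalType) :=
  Pointed.on (T * T')%type.

Lemma continuous_borel_measurable {T T' : ptopologicalType} {f : T -> T'} :
  continuous f -> measurable_fun setT (f : borelType T -> borelType T').
Proof.
move=> /continuousP cf.
apply: (@measurability _ _ (borelType T) (borelType T') setT f (@open T')) => //.
by move=> _ [B oB <-]; rewrite setTI; apply: sub_sigma_algebra; exact: cf.
Qed.

Definition continuous_mfun {T T' : ptopologicalType} {f : T -> T'}
    (cf : continuous f) : {mfun borelType T >-> borelType T'} :=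
  @mfun_Sub _ _ (borelType T) (borelType T') f
    (mem_set (continuous_borel_measurable cf)).

Lemma continuous_real_measurable {R : realType} {T : ptopologicalType}
    {f : T -> R} :
  continuous f -> measurable_fun setT (f : borelType T -> R).
Proof.
move=> /continuousP cf.
apply: (measurability _ (RGenOInfty.measurableE R)) => //.
move=> _ [_ [x ->] <-]; rewrite setTI; apply: sub_sigma_algebra.
exact/cf/interval_open.
Qed.

Lemma mdist_continuous {R : realType} {X : pmetricType R} :
  continuous (fun z : X * X => mdist z.1 z.2).
Proof.
move=> [x y]; apply/cvgrPdist_lt => e e0 /=.
have e2 : 0 < e / 2 by rewrite divr_gt0.
exists (ball x (e / 2), ball y (e / 2)) => /=.
  by split; exact: nbhsx_ballx.
move=> [x' y']; rewrite /= !ballEmdist /= => -[xx' yy'].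
have h1 := metric_triangle x x' y; have h2 := metric_triangle x' y' y.
have h3 := metric_triangle x' x y'; have h4 := metric_triangle x y y'.
move: h2 h3; rewrite (metric_sym x' x) (metric_sym y' y) => h2 h3.
by rewrite ltr_norml; apply/andP; split; lra.
Qed.

Lemma mdist_powR_measurable {R : realType} {X : pmetricType R}
    {T : ptopologicalType} {f g : T -> X} (q : R) :
  continuous f -> continuous g ->
  measurable_fun setT (fun t : borelType T => mdist (f t) (g t) `^ q).
Proof.
move=> cf cg; apply: (measurableT_comp (measurable_powR q)).
apply: continuous_real_measurable => t.
apply: (@continuous_comp _ _ _ (fun t => (f t, g t)) (fun z : X * X => mdist z.1 z.2)).
  by apply: cvg_pair; [exact: cf|exact: cg].
exact: mdist_continuous.
Qed.

(** * Couplings and the Wasserstein distance *)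

Section couplings.
Context {R : realType}.
Local Open Scope ereal_scope.

Lemma mdist_powR_measurable_prod {X : pmetricType R} (q : R) :
  measurable_fun setT
    (fun z : borelType (X * X)%type => (mdist z.1 z.2 `^ q)%:E : \bar R).
Proof.
apply/measurable_EFinP.
have := @mdist_powR_measurable R X (X * X)%type fst snd q.
by apply => z; [exact: cvg_fst|exact: cvg_snd].
Qed.

(** The bundled map mf is kept separate from f because the bundled form of a
    Hoelder map carries another measurability proof than [continuous_mfun]. *)
Lemma coupling_distribution {X U : pmetricType R}
    {P Q : probability (borelType X) R} {f : X -> U}
    {mf : {mfun borelType X >-> borelType U}}
    (cf2 : continuous (fun z : X * X => (f z.1, f z.2)))
    (pi : probability (borelType (X * X)%type) R) :
  mf = f :> (X -> U) -> couplings P Q pi ->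
  couplings (distribution P mf) (distribution Q mf)
    (distribution pi (continuous_mfun cf2)).
Proof.
move=> mfE [pi1 pi2]; split => A mA.
  rewrite -[RHS]/(P (mf @^-1` A)) -pi1; last first.
    by rewrite -[X in measurable X]setTI; exact: measurable_funP.
  by rewrite /pushforward /distribution /pushforward /= mfE.
rewrite -[RHS]/(Q (mf @^-1` A)) -pi2; last first.
  by rewrite -[X in measurable X]setTI; exact: measurable_funP.
by rewrite /pushforward /distribution /pushforward /= mfE.
Qed.

Lemma wasserstein_ge0 {X : pmetricType R} (q : R)
    (P Q : probability (borelType X) R) : 0 <= wasserstein q P Q.
Proof. by apply: le_ereal_inf_tmp => _ [pi _ <-]; exact: poweR_ge0. Qed.

(** The image of P under the diagonal map is a coupling of cost 0. Agreement on
    measurable sets is asked instead of equality of P and Q as bundled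
    measures. *)
Lemma wasserstein_same {X : pmetricType R} (q : R)
    (P Q : probability (borelType X) R) :
  (0 < q)%R -> (forall A : set (borelType X), measurable A -> P A = Q A) ->
  wasserstein q P Q = 0.
Proof.
move=> q0 PQ.
apply/eqP; rewrite eq_le wasserstein_ge0 andbT.
have cd : continuous (fun x : X => (x, x)).
  by move=> x; apply: cvg_pair; exact: cvg_id.
apply: ge_ereal_inf; exists 0 => //.
exists (distribution P (continuous_mfun cd)).
  by split => A mA //; rewrite -PQ.
rewrite ge0_integral_distribution//; last 2 first.
- exact: mdist_powR_measurable_prod.
- by move=> z; rewrite lee_fin powR_ge0.
under eq_integral do rewrite /= mdistxx powR0 ?gt_eqF//.
by rewrite integral0 poweR0r// invr_eq0 gt_eqF.
Qed.

(** The preimage of any set by a constant map is empty or everything. Taking the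
    identity for f shows that all probability measures on a one-point space
    agree. *)
Lemma probability_preimage_const {X U : pmetricType R} (P Q : probability (borelType X) R)
    (f : X -> U) (A : set U) :
  (forall x y, f x = f y) -> P (f @^-1` A) = Q (f @^-1` A).
Proof.
move=> fc; have [Afp|nAfp] := pselect (A (f point)).
  have -> : f @^-1` A = setT.
    by apply/seteqP; split => x //= _; rewrite (fc x point).
  by rewrite !probability_setT.
have -> : f @^-1` A = set0.
  by apply/seteqP; split => x //=; rewrite (fc x point).
by rewrite !measure0.
Qed.

End couplings.

(** * Transport by a Hoelder map *)

Section holder_transport.
Context {R : realType}.
Local Open Scope ereal_scope.

Lemma ge0_ler_poweR (r : R) (x y : \bar R) :
  (0 <= r)%R -> 0 <= x -> x <= y -> x `^ r <= y `^ r.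
Proof.
move=> r0 x0 xy; apply: gt0_ler_poweR => //; rewrite in_itv/= leey andbT//.
exact: le_trans xy.
Qed.

(** Jensen's inequality with exponent q / p, for each coupling separately. *)
Lemma wasserstein_le_exponent {X : pmetricType R} {q p : R}
    (P Q : probability (borelType X) R) :
  (0 < q)%R -> (q <= p)%R -> wasserstein q P Q <= wasserstein p P Q.
Proof.
move=> q0 qp; have p0 := lt_le_trans q0 qp.
apply: le_ereal_inf_tmp => _ [pi cpi <-].
apply: ge_ereal_inf; eexists; first by exists pi.
have -> : (p^-1 = q / p * q^-1)%R by field; rewrite !gt_eqF.
rewrite poweRrM; apply: ge0_ler_poweR.
- by rewrite invr_ge0 ltW.
- by apply: integral_ge0 => z _; rewrite lee_fin powR_ge0.
have qE : (q = p * (q / p))%R by rewrite mulrCA divff ?mulr1// gt_eqF.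
rewrite [leLHS](eq_integral (fun z : borelType (X * X)%type => (mdist z.1 z.2 `^ p `^ (q / p))%:E)); last first.
  by move=> z _; rewrite -powRrM -qE.
apply: jensen_powR.
- by have /measurable_EFinP := @mdist_powR_measurable_prod R X p.
- by move=> z; exact: powR_ge0.
- by rewrite divr_gt0.
- by rewrite ler_pdivrMr// mul1r.
Qed.

Lemma holder_mdist_powR {X U : pmetricType R} {C b : R} {S : X -> U} (p : R)
    (x y : X) :
  (0 <= C)%R -> (0 <= p)%R -> holder_continuous C b S ->
  (mdist (S x) (S y) `^ p <= C `^ p * mdist x y `^ (b * p))%R.
Proof.
move=> C0 p0 hS; rewrite powRrM -powRM ?powR_ge0//.
by apply: ge0_ler_powR => //; rewrite nnegrE ?mdist_ge0// mulr_ge0 ?powR_ge0.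
Qed.

Lemma continuous_map_pair {X U : topologicalType} {f : X -> U} :
  continuous f -> continuous (fun z : X * X => (f z.1, f z.2)).
Proof.
move=> cf z; apply: cvg_pair.
  by apply: continuous_comp; [exact: cvg_fst|exact: cf].
by apply: continuous_comp; [exact: cvg_snd|exact: cf].
Qed.

(** Every coupling pi of P and Q is mapped by S x S to a coupling of the
    pushforwards whose cost is at most C^p times the cost of pi. *)
Lemma wasserstein_holder {X U : pmetricType R} {C b p : R} {S : X -> U}
    (P Q : probability (borelType X) R) (b0 : (0 < b)%R)
    (hS : holder_continuous C b S) :
  (0 < C)%R -> (0 < p)%R ->
  wasserstein p (distribution P (holder_mfun b0 hS))
    (distribution Q (holder_mfun b0 hS))
  <= C%:E * wasserstein (b * p) P Q `^ b.
Proof.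
move=> C0 p0.
set W := (W in W <= _).
have W0 : 0 <= W by exact: wasserstein_ge0.
have CV0 : 0 <= C^-1%:E :> \bar R by rewrite lee_fin invr_ge0 ltW.
(* An infimum is at least any common lower bound of its set, so C and the
   exponent b are first moved to the side of W. *)
suff : (C^-1%:E * W) `^ b^-1 <= wasserstein (b * p) P Q.
  move=> /(@ge0_ler_poweR b) -/(_ (ltW b0) (poweR_ge0 _ _)).
  rewrite -poweRrM mulVf ?gt_eqF// poweRe1 ?mule_ge0// => h.
  by rewrite -lee_pdivrMl.
apply: le_ereal_inf_tmp => _ [pi cpi <-].
rewrite (_ : (b * p)^-1 = p^-1 * b^-1)%R; last by rewrite invfM mulrC.
rewrite poweRrM; apply: ge0_ler_poweR; [by rewrite invr_ge0 ltW|exact: mule_ge0|].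
rewrite lee_pdivrMl//.
have cS := holder_continuous_continuous b0 hS.
have mS : holder_mfun b0 hS = S :> (X -> U) by [].
apply: ge_ereal_inf; eexists.
  exists (distribution pi (continuous_mfun (continuous_map_pair cS))) => //.
  exact: coupling_distribution mS cpi.
rewrite ge0_integral_distribution//; last 2 first.
- exact: mdist_powR_measurable_prod.
- by move=> z; rewrite lee_fin powR_ge0.
rewrite (_ : C%:E = (C `^ p)%:E `^ p^-1); last first.
  by rewrite poweR_EFin -powRrM mulfV ?gt_eqF// powRr1// ltW.
rewrite -poweRM ?lee_fin ?powR_ge0//; last first.
  by apply: integral_ge0 => z _; rewrite lee_fin powR_ge0.
have mc := @mdist_powR_measurable_prod R X (b * p).
apply: ge0_ler_poweR; first by rewrite invr_ge0 ltW.
  by apply: integral_ge0 => z _; rewrite lee_fin powR_ge0.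
rewrite -ge0_integralZl//; last 2 first.
- by move=> z _; rewrite lee_fin powR_ge0.
- by rewrite lee_fin powR_ge0.
apply: ge0_le_integral => //.
- by move=> z _; rewrite lee_fin powR_ge0.
- apply: measurableT_comp; first exact: mdist_powR_measurable_prod.
  exact: measurable_funP.
- exact: measurable_funeM.
- by move=> z _; rewrite -EFinM lee_fin holder_mdist_powR// ltW.
Qed.

Lemma finite_moment_holder {X U : pmetricType R} {C b p : R} {S : X -> U}
    (P : probability (borelType X) R) (b0 : (0 < b)%R)
    (hS : holder_continuous C b S) :
  (b <= 1)%R -> (0 < p)%R -> finite_moment p P ->
  finite_moment p (distribution P (holder_mfun b0 hS)).
Proof.
move=> b1 p0 [x0 Px0].
(* A nonnegative constant allows raising the bound to the power p, whatever the
   sign of C. *)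
have hS' : holder_continuous `|C|%R b S.
  by move=> x y; apply: le_trans (hS x y) _; rewrite ler_wpM2r ?powR_ge0 ?ler_norm.
have cS := holder_continuous_continuous b0 hS.
have md (Y : pmetricType R) (y : Y) q :
    measurable_fun setT (fun x : borelType Y => (mdist x y `^ q)%:E : \bar R).
  apply/measurable_EFinP; apply: mdist_powR_measurable => //.
    by move=> ?; exact: cvg_id.
  by move=> ?; exact: cvg_cst.
exists (S x0); rewrite ge0_integral_distribution//; last first.
  by move=> z; rewrite lee_fin powR_ge0.
apply: (@le_lt_trans _ _ ((`|C| `^ p)%:E * \int[P]_x (mdist x x0 `^ (b * p))%:E)).
  rewrite -ge0_integralZl//; last by move=> z _; rewrite lee_fin powR_ge0.
  apply: ge0_le_integral => //.
  - by move=> z _; rewrite lee_fin powR_ge0.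
  - by apply: measurableT_comp => //; exact: measurable_funP.
  - by apply: measurable_funeM; exact: md.
  - by move=> z _; rewrite -EFinM lee_fin holder_mdist_powR// ltW.
apply: lte_mul_pinfty; rewrite ?lee_fin ?powR_ge0//.
apply: le_lt_trans (poweR_lty b Px0).
under eq_integral do rewrite (mulrC b) powRrM.
apply: jensen_powR => // [|x]; last exact: powR_ge0.
by have /measurable_EFinP := md X x0 p.
Qed.

End holder_transport.

Lemma holder_const {R : realType} {X U : pmetricType R} {C b : R} {S : X -> U} :
  holder_continuous C b S -> C <= 0 -> forall x y, S x = S y.
Proof.
move=> hS C0 x y; apply/eqP; rewrite -[_ == _]negbK -mdist_gt0 -leNgt.
by apply: le_trans (hS x y) _; rewrite mulr_le0_ge0// powR_ge0.
Qed.

(** Two distinct points would be sent to points at negative distance. *)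
Lemma holder_neg_singleton {R : realType} {X U : pmetricType R} {C b : R}
    {S : X -> U} :
  holder_continuous C b S -> C < 0 -> forall x y : X, x = y.
Proof.
move=> hS C0 x y; apply/eqP; rewrite -[_ == _]negbK -mdist_gt0.
apply/negP => xy; have := le_trans (mdist_ge0 _ _) (hS x y).
by rewrite nmulr_rge0// leNgt powR_gt0.
Qed.

Theorem theorem3p2 (R : realType) (X U : pmetricType R) (p : R)
    (P Q : probability (borelType X) R) (b C : R) (S : X -> U)
    (p_ge1 : 1 <= p) (P_p : finite_moment p P) (Q_p : finite_moment p Q)
    (b_gt0 : 0 < b) (b_le1 : b <= 1) (hS : holder_continuous C b S) :
  let SP : probability (borelType U) R :=
    distribution P (holder_mfun b_gt0 hS) in
  let SQ : probability (borelType U) R :=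
    distribution Q (holder_mfun b_gt0 hS) in
  [/\ (wasserstein p SP SQ <= C%:E * wasserstein (b * p) P Q `^ b)%E,
      (C%:E * wasserstein (b * p) P Q `^ b
         <= C%:E * wasserstein p P Q `^ b)%E,
      finite_moment p SP
    & finite_moment p SQ].
Proof.
have p0 : 0 < p by exact: lt_le_trans p_ge1.
have bp0 : 0 < b * p by rewrite mulr_gt0.
have bpp : b * p <= p by rewrite ler_piMl// ltW.
move=> SP SQ; split; [| |exact: finite_moment_holder|exact: finite_moment_holder].
- have [C0|C0] := ltP 0 C; first exact: wasserstein_holder.
  have -> : wasserstein p SP SQ = 0%E.
    apply: wasserstein_same => // A _; apply: (probability_preimage_const P Q S).
    exact: holder_const hS C0.
  (* At C = 0 the right-hand side vanishes even for an infinite distance, since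
     0 * +oo = 0 in the extended reals. *)
  move: C0; rewrite le_eqVlt => /predU1P[->|C0]; first by rewrite mul0e.
  rewrite [X in (_ * X `^ _)%E]wasserstein_same ?poweR0r ?gt_eqF ?mule0// => A _.
  exact: (probability_preimage_const P Q id A (holder_neg_singleton hS C0)).
- have [C0|C0] := leP 0 C.
    apply: lee_wpmul2l; rewrite ?lee_fin//.
    apply: ge0_ler_poweR; [exact: ltW|exact: wasserstein_ge0|].
    exact: wasserstein_le_exponent.
  have PQ A : P A = Q A := probability_preimage_const P Q id A (holder_neg_singleton hS C0).
  by rewrite !wasserstein_same.
Qed.
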